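(* There is a constant $C$ such that every unit distance graph on a convexly independent set of $n\ge2$ points in the plane has at most $2n\log_2 n + Cn$ edges.
   Context: A finite point set $P\subset\mathbb{R}^2$ is convexly independent if no point of $P$ lies in the convex hull of the other points. The unit distance graph on $P$ has vertex set $P$, with $p,q$ adjacent if and only if $|pq|=1$. *)

(* Defs.v *)
From Stdlib Require Import Reals List.
Import ListNotations.
Open Scope R_scope.

Definition point := (R * R)%type.

Definition dist (p q : point) : R :=
  sqrt ((fst p - fst q) ^ 2 + (snd p - snd q) ^ 2).

Definition in_conv_hull (S : list point) (p : point) : Prop :=
  exists w : list R,
    length w = length S /\
    Forall (fun t => 0 <= t) w /\
    fold_right Rplus 0 w = 1 /\
    fst p = fold_right Rplus 0 (map (fun tq => fst tq * fst (snd tq)) (combine w S)) /\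
    snd p = fold_right Rplus 0 (map (fun tq => fst tq * snd (snd tq)) (combine w S)).

Definition convexly_independent (P : list point) : Prop :=
  forall l1 p l2, P = l1 ++ p :: l2 -> ~ in_conv_hull (l1 ++ l2) p.

Definition is_unit (p q : point) : bool :=
  if Req_EM_T (dist p q) 1 then true else false.

Fixpoint unit_edges (P : list point) : nat :=
  match P with
  | [] => 0
  | p :: ps => (length (filter (is_unit p) ps) + unit_edges ps)%nat
  end.

Definition log2 (x : R) : R := ln x / ln 2.

(* Main.v *)
(** Give every vertex of the polygon the supporting direction pointing to its
    counterclockwise successor, and call a unit segment [pq] ahead at [p] if it makes an
    angle at most pi/2 with the supporting direction at [p].  Consider a zigzag of unit
    segments [p'p], [pq], [qq'] with [p, q', q, p'] in counterclockwise order.  If [qq']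
    is ahead at [q], then the angle [pqq'] is smaller than the angle [qpp'].  If [p'] has
    another unit neighbour between [p] and [q'], the reverse inequality holds.

    Hence a unit segment ahead at both ends is the last such segment at one of its ends,
    and one ahead at neither end is the first such at one of its ends: there are at most
    [2n] of those.  Orient every other segment [x -> y] so that it is ahead exactly at
    [y].  The oriented segments contain no [a -> f], [a -> d], [b -> d], [c -> f] with
    [a, b, c, f, d] counterclockwise, which is Füredi's forbidden matrix pattern.  For
    each [f], all but [log2 n + 1] of the segments [a -> f] are such that some later
    [c -> f] is at most half as far from [a] as some later [m -> f]; for each [a], the
    distances from [a] to those [c] at least double from one such [f] to the next, so
    there are at most [log2 n + 1] of them. *)
Require Import Defs.
From Stdlib Require Import Reals List Lra Psatz Permutation Sorted Lia.
Import ListNotations.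
Open Scope R_scope.

(** * Angles in zigzags of unit segments *)

Definition vec (p q : point) : point := (fst q - fst p, snd q - snd p).
Definition dot (u v : point) : R := fst u * fst v + snd u * snd v.
Definition cross (u v : point) : R := fst u * snd v - snd u * fst v.
Definition orient (p q r : point) : R := cross (vec p q) (vec p r).

Lemma orient_cycle p q r : orient p q r = orient q r p.
Proof. unfold orient, cross, vec; cbn; ring. Qed.

Lemma orient_swap p q r : orient p r q = - orient p q r.
Proof. unfold orient, cross, vec; cbn; ring. Qed.

Lemma is_unitP p q : is_unit p q = true -> dot (vec p q) (vec p q) = 1.
Proof.
unfold is_unit; destruct (Req_EM_T (Defs.dist p q) 1) as [e|_]; [intros _|discriminate].
unfold Defs.dist in e; unfold dot, vec; cbn [fst snd].
apply (f_equal (fun x => x * x)) in e.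
rewrite sqrt_sqrt in e; [lra|].
apply Rplus_le_le_0_compat; apply pow2_ge_0.
Qed.

Lemma is_unit_sym p q : is_unit p q = is_unit q p.
Proof.
unfold is_unit; replace (Defs.dist q p) with (Defs.dist p q); [reflexivity|].
unfold Defs.dist; f_equal; ring.
Qed.

Lemma is_unit_irrefl p : is_unit p p = false.
Proof.
unfold is_unit; destruct (Req_EM_T (Defs.dist p p) 1) as [e|_]; [exfalso|reflexivity].
unfold Defs.dist in e.
replace ((fst p - fst p) ^ 2 + (snd p - snd p) ^ 2) with 0 in e by ring.
rewrite sqrt_0 in e; lra.
Qed.

(** [(c, s)] and [(c', s')] are cosine and sine of the zigzag angles phi at [p] and theta at [q];
    [(t1, t2)] is the supporting direction at [q] in the frame of [pq], so that [t1 < 0 < t2]. As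
    [p'] is on its left, [- t1 / t2 <= tan (phi / 2)]; as [qq'] is ahead,
    [tan theta <= - t1 / t2]. *)
Lemma cos_lt_of_tangent c s c' s' t1 t2 :
  c * c + s * s = 1 -> 0 < s -> c' * c' + s' * s' = 1 -> 0 < s' ->
  (t1 <> 0 \/ t2 <> 0) -> 0 <= t2 ->
  0 <= t1 * s + t2 * (1 - c) -> t1 * s' <= t2 * c' -> t1 * c' + t2 * s' <= 0 ->
  c < c'.
Proof.
intros Hc Hs Hc' Hs' Ht H2 H3 H4 H5.
(* With [t2 = 0], the two conditions on [t1 * s] and [t1 * s'] would force [t1 = 0] as well. *)
assert (P2 : 0 < t2).
{ destruct (Rle_lt_or_eq_dec _ _ H2) as [|E]; [assumption|subst t2].
  assert (t1 = 0) by nra. lra. }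
assert (Q1 : t1 < 0).
{ destruct (Rlt_or_le t1 0) as [|Q]; [assumption|].
  assert (0 <= c') by nra. nra. }
assert (Q2 : 0 < c') by nra.
destruct (Rle_or_lt c 0) as [|Pc]; [lra|].
(* [tan theta <= tan (phi / 2) < tan phi] *)
assert (c < 1) by nra.
assert (K1 : s' * s <= (1 - c) * c').
{ apply Rmult_le_reg_l with t2; [assumption|]. nra. }
assert (K2 : s' * c < s * c').
{ apply Rmult_lt_reg_l with s; [assumption|].
  apply Rle_lt_trans with ((1 - c) * c' * c); nra. }
apply Rnot_le_lt; intros K.
assert (s <= s') by nra. nra.
Qed.

(** For angles phi and theta in (0, pi), the last hypothesis reads cos (phi - theta) < cos phi. This
    forces theta > 2 phi, and cosine is decreasing. *)
Lemma cos_lt_of_inner c s c' s' :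
  c * c + s * s = 1 -> 0 < s -> c' * c' + s' * s' = 1 -> 0 < s' ->
  0 < c - (c * c' + s * s') -> c' < c.
Proof.
intros Hc Hs Hc' Hs' H.
assert (c' < 1) by nra.
apply Rnot_le_lt; intros K.
assert (0 < s * s') by (apply Rmult_lt_0_compat; assumption).
assert (0 < c) by (apply Rmult_lt_reg_r with (1 - c'); lra).
assert (s' <= s) by nra.
assert (s' * s' <= s * s') by (apply Rmult_le_compat_r; lra).
nra.
Qed.

(** A unit vector [u] and its quarter turn form an orthonormal frame, in which [v] has coordinates
    [dot u v] and [cross u v]. *)
Lemma lagrange (u v w : point) : dot u u = 1 ->
  dot v w = dot u v * dot u w + cross u v * cross u w.
Proof.
intros H; replace (dot v w) with (dot u u * dot v w) by (rewrite H; ring).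
unfold dot, cross; ring.
Qed.

Lemma lagrange_cross (u v w : point) : dot u u = 1 ->
  cross v w = dot u v * cross u w - cross u v * dot u w.
Proof.
intros H; replace (cross v w) with (dot u u * cross v w) by (rewrite H; ring).
unfold dot, cross; ring.
Qed.

(** Expressed in the frame of the unit vector [pq] with origin [q], the sign conditions on [t]
    become those of [cos_lt_of_tangent]. *)
Lemma angle_lt_of_tangent p q p' q' t :
  dot (vec p q) (vec p q) = 1 -> dot (vec p p') (vec p p') = 1 ->
  dot (vec q q') (vec q q') = 1 ->
  0 < orient p q p' -> 0 < orient q p q' ->
  t <> (0, 0) -> 0 <= cross t (vec q p) -> 0 <= cross t (vec q p') ->
  0 <= cross t (vec q q') -> 0 <= dot t (vec q q') ->
  dot (vec p q) (vec p p') < dot (vec q p) (vec q q').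
Proof.
intros Hu Hv Hw Hs Hs' Ht H1 H2 H3 H4.
set (u := vec p q) in *.
assert (E1 : vec q p = (- fst u, - snd u)) by (unfold u, vec; cbn; f_equal; ring).
set (v := vec p p') in *.
assert (E2 : vec q p' = (fst v - fst u, snd v - snd u))
  by (unfold u, v, vec; cbn; f_equal; ring).
set (w := vec q' q).
assert (E3 : vec q q' = (- fst w, - snd w)) by (unfold w, vec; cbn; f_equal; ring).
unfold orient in Hs, Hs'. fold u v in Hs.
rewrite E1, E3 in *; rewrite E2 in *.
assert (Hw' : dot w w = 1) by (rewrite <- Hw; unfold dot; cbn; ring).
assert (L1 := lagrange u v v Hu). assert (L2 := lagrange u w w Hu).
assert (L3 := lagrange_cross u t v Hu). assert (L4 := lagrange_cross u t w Hu).
assert (L5 := lagrange u t w Hu). assert (L6 := lagrange u t t Hu).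
replace (dot (- fst u, - snd u) (- fst w, - snd w)) with (dot u w)
  by (unfold dot; cbn; ring).
apply (cos_lt_of_tangent _ (cross u v) _ (cross u w) (dot u t) (cross u t)).
- lra.
- exact Hs.
- lra.
- replace (cross u w) with (cross (- fst u, - snd u) (- fst w, - snd w))
    by (unfold cross; cbn; ring). exact Hs'.
- destruct (Req_dec (dot u t) 0) as [Z1|]; [right|left; assumption].
  intros Z2; rewrite Z1, Z2 in L6. apply Ht.
  destruct t as [t1 t2]; unfold dot in L6; cbn in L6.
  f_equal; nra.
- replace (cross u t) with (cross t (- fst u, - snd u)) by (unfold cross; cbn; ring).
  exact H1.
- replace (cross t (fst v - fst u, snd v - snd u)) with (cross t v + cross u t) in H2
    by (unfold cross; cbn; ring). lra.
- replace (cross t (- fst w, - snd w)) with (- cross t w) in H3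
    by (unfold cross; cbn; ring). lra.
- replace (dot t (- fst w, - snd w)) with (- dot t w) in H4
    by (unfold dot; cbn; ring). lra.
Qed.

(** The triangle [p b p'] is isosceles with apex [p'], so its angle at [p] is acute. The ray [pq']
    lies inside this angle, hence also makes an acute angle with [pp']; writing [pq'] as [pq + qq']
    turns this into the hypothesis of [cos_lt_of_inner]. *)
Lemma angle_lt_of_inner_neighbour p b q' q p' :
  dot (vec p q) (vec p q) = 1 -> dot (vec p p') (vec p p') = 1 ->
  dot (vec q q') (vec q q') = 1 -> dot (vec b p') (vec b p') = 1 ->
  0 < orient p q p' -> 0 < orient q p q' ->
  0 < orient p b q' -> 0 < orient p q' p' -> 0 < orient p b p' ->
  dot (vec q p) (vec q q') < dot (vec p q) (vec p p').
Proof.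
intros Hu Hv Hw Hb Hs Hs' O1 O2 O3.
unfold orient in *.
set (u := vec p q) in *. set (v := vec p p') in *.
set (w := vec q' q).
assert (E1 : vec q p = (- fst u, - snd u)) by (unfold u, vec; cbn; f_equal; ring).
assert (E3 : vec q q' = (- fst w, - snd w)) by (unfold w, vec; cbn; f_equal; ring).
assert (E4 : vec p q' = (fst u - fst w, snd u - snd w))
  by (unfold u, w, vec; cbn; f_equal; ring).
set (x := vec p b) in *.
assert (E5 : vec b p' = (fst v - fst x, snd v - snd x))
  by (unfold v, x, vec; cbn; f_equal; ring).
rewrite E1, E3, E5 in *; rewrite E4 in *.
assert (Hw' : dot w w = 1) by (rewrite <- Hw; unfold dot; cbn; ring).
set (y := (fst u - fst w, snd u - snd w)) in *.
assert (X : 0 < dot x v).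
{ assert (X1 : dot x x = 2 * dot x v).
  { replace (dot (fst v - fst x, snd v - snd x) (fst v - fst x, snd v - snd x))
      with (dot v v - 2 * dot x v + dot x x) in Hb by (unfold dot; cbn; ring).
    lra. }
  assert (0 <= dot x x) by (unfold dot; nra).
  destruct (Rle_lt_or_eq_dec 0 (dot x x)) as [|Z]; [assumption|lra|].
  exfalso; unfold dot in Z. assert (fst x = 0) by nra. assert (snd x = 0) by nra.
  unfold cross in O3; nra. }
(* [y] lies in the cone spanned by [x] and [v]. *)
assert (Y : 0 < dot y v).
{ assert (I : dot y v * cross x v = dot x v * cross y v + dot v v * cross x y)
    by (unfold dot, cross; ring).
  apply Rmult_lt_reg_r with (cross x v); [assumption|].
  rewrite I, Rmult_0_l, Hv.
  apply Rplus_lt_0_compat; [apply Rmult_lt_0_compat; assumption|lra]. }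
assert (L1 := lagrange u v v Hu). assert (L2 := lagrange u w w Hu).
assert (L3 := lagrange u v w Hu).
replace (dot (- fst u, - snd u) (- fst w, - snd w)) with (dot u w)
  by (unfold dot; cbn; ring).
apply (cos_lt_of_inner _ (cross u v) _ (cross u w)); try lra.
- replace (cross u w) with (cross (- fst u, - snd u) (- fst w, - snd w))
    by (unfold cross; cbn; ring). exact Hs'.
- replace (dot y v) with (dot u v - dot v w) in Y by (unfold dot, y; cbn; ring). lra.
Qed.

Definition flip (p : point) : point := (fst p, - snd p).

(** Mirror image of [angle_lt_of_tangent], for segments that are not ahead. The supporting direction
    is reflected and then negated: this keeps the polygon on its left and exchanges ahead with
    behind. *)
Lemma angle_lt_of_tangent_flip p q p' q' t :
  dot (vec p q) (vec p q) = 1 -> dot (vec p p') (vec p p') = 1 ->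
  dot (vec q q') (vec q q') = 1 ->
  orient p q p' < 0 -> orient q p q' < 0 ->
  t <> (0, 0) -> 0 <= cross t (vec q p) -> 0 <= cross t (vec q p') ->
  0 <= cross t (vec q q') -> dot t (vec q q') <= 0 ->
  dot (vec p q) (vec p p') < dot (vec q p) (vec q q').
Proof.
intros Hu Hv Hw Hs Hs' Ht H1 H2 H3 H4.
assert (D : forall x y z w, dot (vec (flip x) (flip y)) (vec (flip z) (flip w))
    = dot (vec x y) (vec z w)) by (intros; unfold dot, vec, flip; cbn; ring).
assert (O : forall x y z, orient (flip x) (flip y) (flip z) = - orient x y z)
  by (intros; unfold orient, cross, vec, flip; cbn; ring).
assert (C : forall y z, cross (- fst t, snd t) (vec (flip y) (flip z)) = cross t (vec y z))
  by (intros; unfold cross, vec, flip; cbn; ring).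
rewrite <- (D p q p p'), <- (D q p q q').
apply (angle_lt_of_tangent _ _ _ _ (- fst t, snd t)); rewrite ?D, ?O, ?C; try lra.
- intros E; injection E as E1 E2; apply Ht; destruct t; cbn in *; f_equal; lra.
- replace (dot (- fst t, snd t) (vec (flip q) (flip q'))) with (- dot t (vec q q'))
    by (unfold dot, vec, flip; cbn; ring). lra.
Qed.

(** * Counterclockwise enumeration *)

Definition comb (t : R) (x y : point) : point :=
  (t * fst x + (1 - t) * fst y, t * snd x + (1 - t) * snd y).

Lemma hull_In S x : In x S -> in_conv_hull S x.
Proof.
intros H; apply in_split in H; destruct H as [l1 [l2 ->]].
exists (repeat 0 (length l1) ++ 1 :: repeat 0 (length l2)).
assert (Z : forall l : list point,
  Forall (fun t => 0 <= t) (repeat 0 (length l)) /\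
  fold_right Rplus 0 (repeat 0 (length l)) = 0 /\
  forall g : point -> R, fold_right Rplus 0
    (map (fun tq => fst tq * g (snd tq)) (combine (repeat 0 (length l)) l)) = 0).
{ induction l as [|a l [IH1 [IH2 IH3]]]; cbn; repeat split; try constructor; try lra; auto.
  intros g; rewrite IH3; lra. }
assert (X : forall g : point -> R, fold_right Rplus 0
    (map (fun tq => fst tq * g (snd tq))
       (combine (repeat 0 (length l1) ++ 1 :: repeat 0 (length l2)) (l1 ++ x :: l2)))
    = g x).
{ intros g; induction l1 as [|a l1 IH]; cbn.
  - destruct (Z l2) as [_ [_ Z3]]; rewrite Z3; lra.
  - rewrite IH; lra. }
split; [|split; [|split; [|split]]].
- rewrite !length_app; cbn; rewrite !repeat_length; reflexivity.
- apply Forall_app; split; [apply Z|constructor; [lra|apply Z]].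
- clear X; induction l1 as [|a l1 IH]; cbn.
  + destruct (Z l2) as [_ [Z2 _]]; rewrite Z2; lra.
  + rewrite IH; lra.
- symmetry; apply (X fst).
- symmetry; apply (X snd).
Qed.

Lemma hull_comb S t x y : 0 <= t <= 1 ->
  in_conv_hull S x -> in_conv_hull S y -> in_conv_hull S (comb t x y).
Proof.
intros Ht [w [Lw [Pw [Sw [Xw Yw]]]]] [z [Lz [Pz [Sz [Xz Yz]]]]].
assert (E : exists v, length v = length S /\ Forall (fun t => 0 <= t) v /\
  fold_right Rplus 0 v = t * fold_right Rplus 0 w + (1 - t) * fold_right Rplus 0 z /\
  forall g : point -> R,
    fold_right Rplus 0 (map (fun tq => fst tq * g (snd tq)) (combine v S)) =
    t * fold_right Rplus 0 (map (fun tq => fst tq * g (snd tq)) (combine w S)) +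
    (1 - t) * fold_right Rplus 0 (map (fun tq => fst tq * g (snd tq)) (combine z S))).
{ clear Sw Xw Yw Sz Xz Yz. revert w z Lw Lz Pw Pz.
  induction S as [|s S IH]; intros [|a w] [|b z]; try discriminate; cbn.
  - intros _ _ _ _; exists []; cbn; repeat split; try constructor; intros; lra.
  - intros Lw Lz Pw Pz; injection Lw as Lw; injection Lz as Lz.
    inversion Pw; inversion Pz; subst.
    destruct (IH w z) as [v [L [P [Sv G]]]]; auto.
    exists (t * a + (1 - t) * b :: v); cbn; rewrite L, Sv; repeat split.
    + constructor; [nra|assumption].
    + lra.
    + intros g; rewrite G; lra. }
destruct E as [v [L [P [Sv G]]]].
exists v; split; [assumption|split; [assumption|split; [rewrite Sv; nra|split]]].
- etransitivity; [|symmetry; apply (G fst)]; cbn; rewrite Xw, Xz; reflexivity.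
- etransitivity; [|symmetry; apply (G snd)]; cbn; rewrite Yw, Yz; reflexivity.
Qed.

Lemma not_in_segment P a b t : convexly_independent P -> In a P -> In b P ->
  In (comb t a b) P -> 0 <= t <= 1 -> comb t a b <> a -> comb t a b <> b -> False.
Proof.
intros CI Ha Hb Hm Ht Na Nb.
destruct (in_split _ _ Hm) as [l1 [l2 E]].
apply (CI _ _ _ E); rewrite E in Ha, Hb.
apply hull_comb; [assumption| |]; apply hull_In; apply in_app_iff;
  [apply in_app_iff in Ha; destruct Ha as [|[]]|apply in_app_iff in Hb; destruct Hb as [|[]]];
  auto; congruence.
Qed.

(** The ray [ob] runs between [oa] and [oc]. If [abc] were not a left turn, [b] would lie on the
    same side of [ac] as [o] or on [ac], hence in the triangle [o a c]. *)
Lemma not_in_triangle P o a b c : convexly_independent P ->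
  In o P -> In a P -> In b P -> In c P -> b <> o -> b <> a -> b <> c ->
  0 < orient o a b -> 0 < orient o b c -> 0 < orient o a c -> 0 < orient a b c.
Proof.
intros CI Ho Ha Hb Hc No Na Nc O1 O2 O3.
apply Rnot_le_lt; intros O4.
set (D := orient o a c) in *.
assert (B : orient o a b + orient o b c - orient a b c = D)
  by (unfold D, orient, cross, vec; cbn; ring).
destruct (in_split _ _ Hb) as [l1 [l2 E]].
apply (CI _ _ _ E); rewrite E in Ho, Ha, Hc.
assert (K : forall z, In z (l1 ++ b :: l2) -> b <> z -> in_conv_hull (l1 ++ l2) z).
{ intros z Hz Nz; apply hull_In; apply in_app_iff in Hz; apply in_app_iff.
  destruct Hz as [|[|]]; auto; congruence. }
(* barycentric coordinates of [b] in the triangle [o a c] *)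
set (m := orient o b c + orient o a b).
assert (Pm : 0 < m) by (unfold m; lra).
assert (Hm : 0 < orient o b c / m) by (apply Rdiv_lt_0_compat; assumption).
assert (Hm' : orient o b c / m <= 1).
{ apply Rmult_le_reg_r with m; [assumption|]. unfold Rdiv; rewrite Rmult_assoc, Rinv_l by lra.
  unfold m; lra. }
assert (Hd : 0 < m / D) by (apply Rdiv_lt_0_compat; assumption).
assert (Hd' : m / D <= 1).
{ apply Rmult_le_reg_r with D; [assumption|]. unfold Rdiv; rewrite Rmult_assoc, Rinv_l by lra.
  unfold m; lra. }
(* The inner combination is the point where the ray from [o] through [b] meets [ac]; the outer one
   moves it back towards [o]. *)
replace b with (comb (m / D) (comb (orient o b c / m) a c) o).
- apply hull_comb; [lra| |apply K; assumption].
  apply hull_comb; [lra|apply K; assumption|apply K; assumption].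
- transitivity (fst b, snd b); [|symmetry; apply surjective_pairing].
  unfold comb; cbn [fst snd].
  assert (I1 : D * fst b = orient o b c * fst a + orient o a b * fst c + (D - m) * fst o)
    by (unfold m, D, orient, cross, vec; cbn; ring).
  assert (I2 : D * snd b = orient o b c * snd a + orient o a b * snd c + (D - m) * snd o)
    by (unfold m, D, orient, cross, vec; cbn; ring).
  assert (m <> 0) by lra. assert (D <> 0) by lra.
  f_equal; apply Rmult_eq_reg_l with D; try assumption;
    [rewrite I1|rewrite I2]; replace (orient o a b) with (m - orient o b c) by (unfold m; ring);
    field; split; assumption.
Qed.

(** * Angular order around the lexicographically least point *)

Definition lex_lt (p q : point) : Prop :=
  fst p < fst q \/ (fst p = fst q /\ snd p < snd q).

Lemma lex_total p q : p <> q -> lex_lt p q \/ lex_lt q p.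
Proof.
intros N; unfold lex_lt; destruct (Rtotal_order (fst p) (fst q)) as [|[E|]]; auto.
destruct (Rtotal_order (snd p) (snd q)) as [|[E'|]]; auto.
exfalso; apply N; destruct p, q; cbn in *; congruence.
Qed.

Lemma lex_min_exists l : NoDup l -> l <> [] ->
  exists o l', Permutation l (o :: l') /\ Forall (lex_lt o) l'.
Proof.
induction l as [|a l IH]; [congruence|intros ND _].
inversion ND as [|? ? Na ND']; subst.
destruct l as [|b l]; [exists a, []; split; auto|].
destruct (IH ND') as [o [l' [Pm F]]]; [discriminate|].
assert (N : a <> o).
{ intros ->; apply Na; apply Permutation_in with (o :: l'); [symmetry; assumption|left; reflexivity]. }
destruct (lex_total _ _ N) as [L|L].
- exists a, (b :: l); split; [reflexivity|].
  apply Permutation_Forall with (o :: l'); [symmetry; assumption|].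
  constructor; [assumption|]; revert F; apply Forall_impl; intros x.
  unfold lex_lt in *; intros; lra.
- exists o, (a :: l'); split; [|constructor; assumption].
  rewrite Pm; apply perm_swap.
Qed.

(** Insertion sort. Totality and transitivity are asked for members of [l] only, because the angular
    order around [o] has them only on points lexicographically above [o]. *)
Lemma sort_exists {T : Type} (lt : T -> T -> Prop) (l : list T) :
  NoDup l ->
  (forall x y, In x l -> In y l -> x <> y -> lt x y \/ lt y x) ->
  (forall x y z, In x l -> In y l -> In z l -> lt x y -> lt y z -> lt x z) ->
  exists l', Permutation l l' /\ StronglySorted lt l'.
Proof.
induction l as [|a l IH]; intros ND Tot Tr.
- exists []; split; constructor.
- inversion ND as [|? ? Na ND']; subst.
  destruct IH as [l' [Pm So]]; auto.
  { intros; apply Tot; cbn; auto. }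
  { intros x y z ? ? ?; apply Tr; cbn; auto. }
  assert (Tot' : forall x, In x l' -> lt a x \/ lt x a).
  { intros x Hx; assert (In x l) by (eapply Permutation_in; [symmetry; eassumption|assumption]).
    apply Tot; cbn; auto. intros ->; auto. }
  assert (Tr' : forall x y, In x l' -> In y l' -> lt a x -> lt x y -> lt a y).
  { intros x y Hx Hy; apply Tr; cbn; auto; right;
      (eapply Permutation_in; [symmetry; eassumption|assumption]). }
  assert (J : exists l'', Permutation (a :: l') l'' /\ StronglySorted lt l'').
  { clear - So Tot' Tr'. induction l' as [|b l' IH].
    - exists [a]; split; [reflexivity|repeat constructor].
    - inversion So as [|? ? So' Fb]; subst.
      destruct (Tot' b) as [L|L]; [left; reflexivity| |].
      + exists (a :: b :: l'); split; [reflexivity|].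
        constructor; [assumption|]. constructor; [assumption|].
        apply Forall_forall; intros y Hy; rewrite Forall_forall in Fb.
        apply (Tr' b); cbn; auto.
      + destruct IH as [l'' [Pm So'']]; auto.
        { intros; apply Tot'; cbn; auto. }
        { intros x y ? ?; apply Tr'; cbn; auto. }
        exists (b :: l''); split.
        * rewrite <- Pm; apply perm_swap.
        * constructor; [assumption|].
          apply Permutation_Forall with (a :: l'); [assumption|constructor; assumption]. }
  destruct J as [l'' [Pm' So'']]; exists l''; split; [|assumption].
  rewrite Pm; assumption.
Qed.

Lemma StronglySorted_nth {T : Type} (lt : T -> T -> Prop) (l : list T) d i j :
  StronglySorted lt l -> (i < j < length l)%nat -> lt (nth i l d) (nth j l d).
Proof.
intros So; revert i j; induction So as [|a l So IH F]; intros i j H; cbn in H; [lia|].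
destruct j as [|j]; [lia|]; destruct i as [|i]; cbn.
- rewrite Forall_forall in F; apply F, nth_In; lia.
- apply IH; lia.
Qed.

(** Points lexicographically above [o] span directions in a half-open half-plane, where turning left
    never wraps around. *)
Lemma orient_trans o a b c : lex_lt o a -> lex_lt o b -> lex_lt o c ->
  0 < orient o a b -> 0 < orient o b c -> 0 < orient o a c.
Proof.
unfold lex_lt, orient, cross, vec; cbn [fst snd].
set (x1 := fst a - fst o); set (y1 := snd a - snd o).
set (x2 := fst b - fst o); set (y2 := snd b - snd o).
set (x3 := fst c - fst o); set (y3 := snd c - snd o).
intros Ha Hb Hc.
assert (Ha' : 0 < x1 \/ (x1 = 0 /\ 0 < y1)) by (unfold x1, y1; lra).
assert (Hb' : 0 < x2 \/ (x2 = 0 /\ 0 < y2)) by (unfold x2, y2; lra).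
assert (Hc' : 0 < x3 \/ (x3 = 0 /\ 0 < y3)) by (unfold x3, y3; lra).
clear Ha Hb Hc; clearbody x1 y1 x2 y2 x3 y3; intros H1 H2.
assert (X1 : 0 < x1).
{ destruct Ha' as [|[-> ?]]; [assumption|exfalso].
  destruct Hb' as [|[-> ?]]; nra. }
destruct Hc' as [X3|[-> Y3]]; [|nra].
assert (X2 : 0 < x2).
{ destruct Hb' as [|[-> ?]]; [assumption|exfalso; nra]. }
(* [x2 * (x1 y3 - y1 x3) = x1 (x2 y3 - y2 x3) + x3 (x1 y2 - y1 x2)] *)
apply Rmult_lt_reg_l with x2; [assumption|].
nra.
Qed.

(** If collinear with [o], the points [a] and [b] would lie on one ray from [o], and the nearer
    would be on the segment from [o] to the farther. *)
Lemma not_collinear P o a b : convexly_independent P -> In o P -> In a P -> In b P ->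
  lex_lt o a -> lex_lt o b -> a <> b -> orient o a b <> 0.
Proof.
intros CI.
assert (W : forall a b t, In o P -> In a P -> In b P -> lex_lt o b -> a <> b -> b = comb t a o ->
  0 <= t <= 1 -> False).
{ intros a' b' t Ho Ha Hb L N E Ht. apply (not_in_segment P a' o t); auto; rewrite <- E; auto.
  intros ->; unfold lex_lt in L; lra. }
intros Ho Ha Hb La Lb N Z.
unfold orient, cross, vec in Z; cbn [fst snd] in Z.
assert (V : forall a b : point, forall t, fst b - fst o = t * (fst a - fst o) ->
   snd b - snd o = t * (snd a - snd o) -> b = comb t a o).
{ intros a' [b1 b2] t; unfold comb; cbn; intros; f_equal; lra. }
(* On a vertical ray the ratio of the two points is read off the second coordinates, otherwise off
   the first. *)
destruct (Rle_lt_dec (fst a - fst o) 0) as [A1|A1].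
- assert (EA : fst a - fst o = 0) by (unfold lex_lt in La; lra).
  assert (A2 : 0 < snd a - snd o) by (unfold lex_lt in La; lra).
  assert (EB : fst b - fst o = 0) by nra.
  assert (B2 : 0 < snd b - snd o) by (unfold lex_lt in Lb; lra).
  destruct (Rle_lt_dec (snd b - snd o) (snd a - snd o)) as [L|L].
  + apply (W a b ((snd b - snd o) / (snd a - snd o))); auto.
    * apply V; [rewrite EA, EB; ring|field; lra].
    * split; [apply Rlt_le, Rdiv_lt_0_compat; lra|].
      apply Rmult_le_reg_r with (snd a - snd o); [lra|].
      unfold Rdiv; rewrite Rmult_assoc, Rinv_l; lra.
  + apply (W b a ((snd a - snd o) / (snd b - snd o))); auto.
    * apply V; [rewrite EA, EB; ring|field; lra].
    * split; [apply Rlt_le, Rdiv_lt_0_compat; lra|].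
      apply Rmult_le_reg_r with (snd b - snd o); [lra|].
      unfold Rdiv; rewrite Rmult_assoc, Rinv_l; lra.
- assert (B1 : 0 < fst b - fst o).
  { destruct Lb as [|[E L]]; [lra|].
    exfalso; assert (E' : fst b - fst o = 0) by lra.
    rewrite E' in Z. nra. }
  destruct (Rle_lt_dec (fst b - fst o) (fst a - fst o)) as [L|L].
  + apply (W a b ((fst b - fst o) / (fst a - fst o))); auto.
    * apply V; [field; lra|].
      apply Rmult_eq_reg_r with (fst a - fst o); [|lra]; field_simplify; [|lra]; lra.
    * split; [apply Rlt_le, Rdiv_lt_0_compat; lra|].
      apply Rmult_le_reg_r with (fst a - fst o); [lra|].
      unfold Rdiv; rewrite Rmult_assoc, Rinv_l; lra.
  + apply (W b a ((fst a - fst o) / (fst b - fst o))); auto.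
    * apply V; [field; lra|].
      apply Rmult_eq_reg_r with (fst b - fst o); [|lra]; field_simplify; [|lra]; lra.
    * split; [apply Rlt_le, Rdiv_lt_0_compat; lra|].
      apply Rmult_le_reg_r with (fst b - fst o); [lra|].
      unfold Rdiv; rewrite Rmult_assoc, Rinv_l; lra.
Qed.

(** Start at the lexicographically least point [o] and sort the rest by angle around it. Triples
    containing [o] turn left by sortedness, all others by [not_in_triangle]. *)
Theorem convex_sort P : NoDup P -> P <> [] -> convexly_independent P ->
  exists Q, Permutation P Q /\
    forall i j k, (i < j)%nat -> (j < k)%nat -> (k < length Q)%nat ->
      0 < orient (nth i Q (0, 0)) (nth j Q (0, 0)) (nth k Q (0, 0)).
Proof.
intros ND NE CI.
destruct (lex_min_exists P ND NE) as [o [l [Pm F]]].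
rewrite Forall_forall in F.
assert (NDl : NoDup (o :: l)) by (apply Permutation_NoDup with P; assumption).
inversion NDl as [|? ? No NDl']; subst.
assert (InP : forall x, In x (o :: l) -> In x P)
  by (intros x; apply Permutation_in; symmetry; assumption).
destruct (sort_exists (fun a b => 0 < orient o a b) l) as [l' [Pm' So]]; auto.
- intros x y Hx Hy N.
  assert (Z := not_collinear P o x y CI (InP _ (or_introl eq_refl))
     (InP _ (or_intror Hx)) (InP _ (or_intror Hy)) (F _ Hx) (F _ Hy) N).
  assert (orient o y x = - orient o x y) by (unfold orient, cross, vec; cbn; ring).
  destruct (Rtotal_order (orient o x y) 0) as [|[|]]; [right|contradiction|left]; lra.
- intros x y z Hx Hy Hz; apply orient_trans; auto.
- exists (o :: l'); split; [rewrite Pm; constructor; assumption|].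
  intros i j k Hij Hjk Hk; cbn [length] in Hk.
  assert (S2 : forall i j, (i < j < length l')%nat ->
      0 < orient o (nth i l' (0, 0)) (nth j l' (0, 0)))
    by (intros; apply (StronglySorted_nth _ _ _ _ _ So); assumption).
  destruct j as [|j]; [lia|]; destruct k as [|k]; [lia|].
  destruct i as [|i]; cbn [nth]; [apply S2; lia|].
  assert (InP' : forall i, (i < length l')%nat -> In (nth i l' (0, 0)) l).
  { intros m Hm; apply Permutation_in with l'; [symmetry; assumption|apply nth_In; assumption]. }
  assert (Neq : forall i j, (i < j < length l')%nat -> nth i l' (0, 0) <> nth j l' (0, 0)).
  { intros m m' Hm E; assert (X := S2 m m' Hm); rewrite E in X.
    unfold orient, cross in X; lra. }
  apply (not_in_triangle P o); auto; try (apply S2; lia);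
    try (apply InP; right; apply InP'; lia).
  + apply InP; left; reflexivity.
  + intros E; apply No; rewrite <- E; apply InP'; lia.
  + intros E; apply (Neq i j); [lia|auto].
  + apply Neq; lia.
Qed.

Lemma unit_edges_perm P Q : Permutation P Q -> unit_edges P = unit_edges Q.
Proof.
intros H; induction H as [|x l l' H IH|x y l|l l' l'' _ IH1 _ IH2]; cbn.
- reflexivity.
- rewrite IH; f_equal.
  clear IH; induction H as [|z l l' H IH|z w l|l l' l'' _ IH1 _ IH2]; cbn.
  + reflexivity.
  + destruct (is_unit x z); cbn; congruence.
  + destruct (is_unit x z), (is_unit x w); reflexivity.
  + congruence.
- rewrite (is_unit_sym y x); destruct (is_unit x y); cbn; lia.
- congruence.
Qed.

(** * Counting charged segments *)

Module Polygon.
From mathcomp Require Import all_boot zify.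
(* MathComp's [ring_scope] takes over the key [R]. *)
Delimit Scope R_scope with coqR.
Local Open Scope nat_scope.
Set Implicit Arguments.
Unset Strict Implicit.

(** With vertices numbered counterclockwise, comparing these distances from one vertex encodes the
    cyclic order. *)
Definition ccw_dist (n i j : nat) : nat := if i <= j then j - i else n + j - i.

(** Values at least a factor two apart have distinct binary logarithms rounded down, all between 0
    and that of [N]. *)
Lemma card_doubling (T : finType) (S : {pred T}) (v : T -> nat) (N : nat) :
    (forall x, x \in S -> 0 < v x <= N) ->
    (forall x y, x \in S -> y \in S -> x != y ->
       (2 * v x <= v y) || (2 * v y <= v x)) ->
  #|S| <= (trunc_log 2 N).+1.
Proof.
move=> v_bd v_dbl.
pose g x : 'I_(trunc_log 2 N).+1 := inord (trunc_log 2 (v x)).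
have g_val x : x \in S -> g x = trunc_log 2 (v x) :> nat.
  by move=> /v_bd /andP[_ vN]; rewrite inordK // ltnS leq_trunc_log.
have g_inj : {in S &, injective g}.
  have step x y : x \in S -> y \in S -> 2 * v x <= v y -> g x = g y -> x = y.
    move=> xS yS le2 /(congr1 val) /=; rewrite !g_val //.
    have /andP[vx_gt0 _] := v_bd _ xS.
    by have := leq_trunc_log 2 le2; rewrite trunc_logMp //; lia.
  move=> x y xS yS gxy; apply/eqP; apply: contraT => ne.
  have /orP[le2|le2] := v_dbl _ _ xS yS ne; first by rewrite (step x y) ?eqxx in ne.
  by rewrite (step y x) ?eqxx in ne.
by rewrite -(card_ord (trunc_log 2 N).+1) -(card_in_image g_inj) max_card.
Qed.

(** * The charging scheme over an abstract cyclic order *)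

Section DirectedPattern.
Variables (n : nat) (U A : rel 'I_n).
Local Notation arc := (ccw_dist n).

Definition both p q := [&& U p q, A p q & A q p].
Definition neither p q := [&& U p q, ~~ A p q & ~~ A q p].
Definition mixed p q := [&& U p q, ~~ A p q & A q p].

Definition last_both p q :=
  both p q && [forall q', both p q' ==> (arc p q' <= arc p q)].
Definition first_neither p q :=
  neither p q && [forall q', neither p q' ==> (arc p q <= arc p q')].

Definition doubling a f c m :=
  [&& mixed c f, mixed m f, 0 < arc a c, 2 * arc a c <= arc a m
    & arc a m < arc a f].
Definition doubled a f := mixed a f && [exists c, exists m, doubling a f c m].
(** The head [f] comes first, so that [charged] books these segments at [f], but the [doubled] ones
    at their tail. *)
Definition undoubled f a := mixed a f && ~~ [exists c, exists m, doubling a f c m].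

Definition charged p q :=
  [|| last_both p q, first_neither p q, doubled p q | undoubled p q].

Hypothesis U_sym : symmetric U.
Hypothesis no_both : forall p q p' q', both p q -> both p p' -> both q q' ->
  arc p q < arc p p' -> arc q p < arc q q' -> False.
Hypothesis no_neither : forall p q p' q',
  neither p q -> neither p p' -> neither q q' ->
  arc p p' < arc p q -> arc q q' < arc q p -> False.
Hypothesis no_mixed : forall a b c f d,
  mixed a f -> mixed a d -> mixed b d -> mixed c f ->
  0 < arc a b -> arc a b < arc a c -> arc a c < arc a f -> arc a f < arc a d ->
  False.
Hypothesis U_irr : irreflexive U.

Lemma arc_inj (p q q' : 'I_n) : arc p q = arc p q' -> q = q'.
Proof.
move=> e; apply/val_inj => /=; move: e; rewrite /ccw_dist.
by have := ltn_ord q; have := ltn_ord q'; have := ltn_ord p;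
   case: (leqP p q); case: (leqP p q'); lia.
Qed.

Lemma arc_gt0 (p q : 'I_n) : (0 < arc p q) = (p != q).
Proof.
rewrite -val_eqE /= /ccw_dist.
by have := ltn_ord q; have := ltn_ord p; case: (leqP p q); lia.
Qed.

Lemma arc_lt (p q : 'I_n) : arc p q < n.
Proof.
by rewrite /ccw_dist; have := ltn_ord q; have := ltn_ord p; case: (leqP p q); lia.
Qed.

Lemma arc_cat (f a c : 'I_n) : arc f a <= arc f c -> arc f c = arc f a + arc a c.
Proof.
rewrite /ccw_dist; have := ltn_ord f; have := ltn_ord a; have := ltn_ord c.
by case: (leqP f c); case: (leqP f a); case: (leqP a c); lia.
Qed.

Lemma arc_rev (f a : 'I_n) : f != a -> arc a f = n - arc f a.
Proof.
rewrite -val_eqE /= /ccw_dist; have := ltn_ord f; have := ltn_ord a.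
by case: (leqP f a); case: (leqP a f); lia.
Qed.

Lemma mixed_neq a f : mixed a f -> a != f.
Proof. by move=> /and3P[+ _ _]; apply: contraTneq => ->; rewrite U_irr. Qed.

Lemma not_last_both p q : both p q -> ~~ last_both p q ->
  exists2 p', both p p' & arc p q < arc p p'.
Proof.
rewrite /last_both => -> /=; rewrite negb_forall => /existsP[p'].
by rewrite negb_imply -ltnNge => /andP[]; exists p'.
Qed.

Lemma not_first_neither p q : neither p q -> ~~ first_neither p q ->
  exists2 p', neither p p' & arc p p' < arc p q.
Proof.
rewrite /first_neither => -> /=; rewrite negb_forall => /existsP[p'].
by rewrite negb_imply -ltnNge => /andP[]; exists p'.
Qed.

(** A segment ahead at both ends that is last at neither would have a longer-arc partner at each
    end, against [no_both]; dually for [no_neither]. A mixed segment is either doubled or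
    undoubled. *)
Lemma charged_cover p q : U p q -> charged p q || charged q p.
Proof.
move=> Upq; have Uqp : U q p by rewrite U_sym.
apply: contraT; rewrite negb_or /charged !negb_or.
move=> /andP[/and4P[Lpq Fpq Dpq Epq] /and4P[Lqp Fqp Dqp Eqp]].
case Apq: (A p q); case Aqp: (A q p).
- have bpq : both p q by rewrite /both Upq Apq.
  have bqp : both q p by rewrite /both Uqp Apq Aqp.
  have [p' bpp' ltp] := not_last_both bpq Lpq.
  have [q' bqq' ltq] := not_last_both bqp Lqp.
  by case: (no_both bpq bpp' bqq' ltp ltq).
- have mqp : mixed q p by rewrite /mixed Uqp Aqp Apq.
  by move: Dqp Epq; rewrite /doubled /undoubled mqp /= => /negPf->.
- have mpq : mixed p q by rewrite /mixed Upq Aqp Apq.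
  by move: Dpq Eqp; rewrite /doubled /undoubled mpq /= => /negPf->.
- have bpq : neither p q by rewrite /neither Upq Apq Aqp.
  have bqp : neither q p by rewrite /neither Uqp Apq Aqp.
  have [p' bpp' ltp] := not_first_neither bpq Fpq.
  have [q' bqq' ltq] := not_first_neither bqp Fqp.
  by case: (no_neither bpq bpp' bqq' ltp ltq).
Qed.

Lemma card_last_both p : #|last_both p| <= 1.
Proof.
apply/card_le1_eqP => q q'; rewrite !unfold_in.
move=> /andP[bq /forallP Fq] /andP[bq' /forallP Fq'].
have := Fq q'; have := Fq' q; rewrite bq bq' /= => l1 l2.
by apply: (@arc_inj p); apply/eqP; rewrite eqn_leq l1 l2.
Qed.

Lemma card_first_neither p : #|first_neither p| <= 1.
Proof.
apply/card_le1_eqP => q q'; rewrite !unfold_in.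
move=> /andP[bq /forallP Fq] /andP[bq' /forallP Fq'].
have := Fq q'; have := Fq' q; rewrite bq bq' /= => l1 l2.
by apply: (@arc_inj p); apply/eqP; rewrite eqn_leq l1 l2.
Qed.

(** The chosen distances [arc a (c f)] double: if [f] precedes [d], the witness [m] of [f] cannot
    come after [b = c d], since [a, b, m, f, d] would be the forbidden pattern. So
    [2 * arc a (c f) <= arc a m <= arc a b]. *)
Lemma card_doubled a : #|doubled a| <= (trunc_log 2 n).+1.
Proof.
(* The default [a] is never taken when [f] is in [doubled a]. *)
pose c f := odflt a [pick c | [exists m, doubling a f c m]].
have cP f : f \in doubled a -> exists m, doubling a f (c f) m.
  rewrite unfold_in => /andP[_ /existsP[c0 c0P]]; rewrite /c.
  by case: pickP => [c1 /existsP //|/(_ c0)]; rewrite c0P.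
apply: (@card_doubling _ _ (fun f => arc a (c f))) => [f fD | f d fD dD].
  by have [m /and5P[_ _ -> _ _]] := cP f fD; rewrite ltnW // arc_lt.
wlog ltfd : f d fD dD / arc a f < arc a d.
  move=> W ne; case: (ltngtP (arc a f) (arc a d)) => [l|l|e].
  - exact: W.
  - by rewrite orbC; apply: W => //; rewrite eq_sym.
  - by rewrite (arc_inj e) eqxx in ne.
move=> _; apply/orP; left.
have maf : mixed a f by case/andP: fD.
have mad : mixed a d by case/andP: dD.
have [m /and5P[_ mmf _ dbl ltm]] := cP f fD.
have [m' /and5P[mbd _ b_gt0 _ _]] := cP d dD.
apply: leq_trans dbl _; rewrite leqNgt; apply/negP => ltb.
exact: (no_mixed maf mad mbd mmf).
Qed.

(** Let [m] be the last tail before [f]. For undoubled [a] and a later tail [b], the pair [b, m]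
    fails to double, so [arc a m < 2 * arc a b], that is [2 * arc b m < arc a m]: the distances to
    [m] double going backwards. *)
Lemma card_undoubled f : #|undoubled f| <= (trunc_log 2 n).+1.
Proof.
pose F (a : 'I_n) := arc f a; pose M := \max_(a in [pred a | mixed a f]) F a.
have leM a : a \in undoubled f -> arc f a <= M.
  by move=> /andP[ma _]; exact: (leq_bigmax_cond (F := F)).
have M_lt a : a \in undoubled f -> M < n.
  move=> /andP[ma _]; have [|m _ eM] := eq_bigmax_cond F (A := [pred a | mixed a f]).
    by apply/card_gt0P; exists a.
  by rewrite /M eM arc_lt.
(* The value is [arc a m + 1]. The increment makes it positive at [a = m], and the strict inequality
   between distances leaves room for it. *)
apply: (@card_doubling _ _ (fun a : 'I_n => (M - arc f a).+1)) => [a aD | a b aD bD].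
  by have := M_lt a aD; lia.
wlog ltab : a b aD bD / arc f a < arc f b.
  move=> W ne; case: (ltngtP (arc f a) (arc f b)) => [l|l|e].
  - exact: W.
  - by rewrite orbC; apply: W => //; rewrite eq_sym.
  - by rewrite (arc_inj e) eqxx in ne.
move=> _; apply/orP; right.
have [|m mm eM] := eq_bigmax_cond F (A := [pred a | mixed a f]).
  by apply/card_gt0P; exists a; case/andP: aD.
rewrite -/M /F in eM.
have leb := leM b bD; rewrite eM in leb *.
have [maf /existsPn /(_ b) /existsPn /(_ m)] := andP aD.
have mbf : mixed b f by case/andP: bD.
have eb := arc_cat (ltnW ltab); have em := arc_cat (leq_trans (ltnW ltab) leb).
have mmf : mixed m f by [].
have na := mixed_neq maf; have nm := mixed_neq mmf.
rewrite /doubling mbf mmf /= => H.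
have r1 := arc_rev na; have r2 := arc_rev nm.
rewrite eq_sym in na; have r3 := arc_rev na.
rewrite eq_sym in nm; have nm0 : 0 < arc m f by rewrite arc_gt0 eq_sym.
have l1 := arc_lt f m.
by move: H; rewrite !negb_and; lia.
Qed.

Theorem card_pattern_free :
  \sum_(i < n) \sum_(j < n) ((i < j) && U i j)
    <= n * (2 * trunc_log 2 n + 4).
Proof.
have le1 : \sum_(i < n) \sum_(j < n) ((i < j) && U i j)
   <= \sum_(i < n) \sum_(j < n) (charged i j : nat).
  (* Splitting by [i < j] and exchanging the indices of the second half brings the two possible
     charges of a pair into one term. *)
  have -> : \sum_(i < n) \sum_(j < n) (charged i j : nat) =
     \sum_(i < n) \sum_(j < n) ((i < j) && charged i j) +
     \sum_(i < n) \sum_(j < n) (~~ (i < j) && charged i j).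
    rewrite -big_split; apply: eq_bigr => i _; rewrite -big_split.
    by apply: eq_bigr => j _ /=; case: (i < j); case: (charged i j).
  rewrite [X in _ <= _ + X]exchange_big -big_split; apply: leq_sum => i _ /=.
  rewrite -big_split; apply: leq_sum => j _ /=.
  case: (ltnP i j) => //= lij; rewrite -leqNgt (ltnW lij) /=.
  case Uij: (U i j) => //=; have := charged_cover Uij.
  by case: (charged i j); case: (charged j i).
apply: leq_trans le1 _.
rewrite -[n in n * _]card_ord -sum_nat_const; apply: leq_sum => i _.
have -> : \sum_(j < n) (charged i j : nat) = #|charged i|.
  by rewrite -sum1_card [RHS]big_mkcond; apply: eq_bigr => j _; rewrite unfold_in -/(charged i j); case: (charged i j).
have sub : #|charged i| <=
    #|[predU last_both i & [predU first_neither i & [predU doubled i & undoubled i]]]|.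
  by apply/subset_leq_card/subsetP => j; rewrite !inE !unfold_in.
apply: leq_trans sub _.
have cU (S T : {pred 'I_n}) : #|[predU S & T]| <= #|S| + #|T|.
  by rewrite -cardUI leq_addr.
have -> : 2 * trunc_log 2 n + 4 =
    1 + (1 + ((trunc_log 2 n).+1 + (trunc_log 2 n).+1)) by lia.
apply: leq_trans (cU _ _) (leq_add (card_last_both i) _).
apply: leq_trans (cU _ _) (leq_add (card_first_neither i) _).
exact: leq_trans (cU _ _) (leq_add (card_doubled i) (card_undoubled i)).
Qed.
End DirectedPattern.

Lemma unit_edgesE (s : list point) (x0 : point) :
  unit_edges s = \sum_(i < length s) \sum_(j < length s)
    ((i < j) && is_unit (List.nth i s x0) (List.nth j s x0)).
Proof.
elim: s => [|p s IH]; first by rewrite big_ord0.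
rewrite [RHS]big_ord_recl big_ord_recl /= add0n; congr addn.
  by elim: s {IH} => [|q s IH]; rewrite ?big_ord0 // big_ord_recl /= -IH; case: is_unit.
by rewrite IH; apply: eq_bigr => i _; rewrite big_ord_recl.
Qed.

(** * Convex polygons satisfy the hypotheses of the charging scheme *)

Section ConvexPolygon.
Variables (n : nat) (pt : nat -> point).
Hypothesis pt_ccw : forall i j k, i < j -> j < k -> k < n ->
  (0 < orient (pt i) (pt j) (pt k))%coqR.
Hypothesis pt_inj : forall i j, i < j -> j < n -> pt i <> pt j.
Hypothesis n_gt1 : 1 < n.
Local Notation arc := (ccw_dist n).

(** Some rotation of [i, j, k] is increasing, and orientation is invariant under rotation. *)
Lemma orient_arc (i j k : 'I_n) : 0 < arc i j -> arc i j < arc i k ->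
  (0 < orient (pt i) (pt j) (pt k))%coqR.
Proof.
move=> h1 h2.
have [[ij jk]|[[jk ki]|[ki ij]]] : (i < j /\ j < k) \/ (j < k /\ k < i) \/ (k < i /\ i < j).
  move: h1 h2; rewrite /ccw_dist; have := ltn_ord i; have := ltn_ord j; have := ltn_ord k.
  by case: (leqP i j); case: (leqP i k); lia.
- exact: pt_ccw.
- by rewrite orient_cycle; apply: pt_ccw.
- by rewrite -orient_cycle; apply: pt_ccw.
Qed.

Definition tangent (i : nat) : point := vec (pt i) (pt (if i.+1 == n then 0 else i.+1)).

Lemma tangent_neq0 (i : 'I_n) : tangent i <> (0, 0)%coqR.
Proof.
rewrite /tangent /vec => -[e1 e2].
have e : pt (if i.+1 == n then 0 else i.+1) = pt i.
  by move: e1 e2; case: (pt _) => a b; case: (pt i) => c d /= *; congr pair; lra.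
move: e; have := ltn_ord i; case: eqP => [ei _ e|ni lt e].
  by apply: (@pt_inj 0 i) => //; lia.
by apply: (@pt_inj i i.+1) => //; lia.
Qed.

Lemma tangent_support (i j : 'I_n) : (0 <= cross (tangent i) (vec (pt i) (pt j)))%coqR.
Proof.
rewrite /tangent -/(orient _ _ _).
have [->|ne] := eqVneq j i; first by rewrite /orient /cross /vec /=; lra.
rewrite -val_eqE /= in ne.
have lti := ltn_ord i; have ltj := ltn_ord j.
case: eqP => [ei|ni].
  have [->|j0] := eqVneq (j : nat) 0; first by rewrite /orient /cross /vec /=; lra.
  by rewrite orient_cycle; apply/Rlt_le/pt_ccw; lia.
have [->|j0] := eqVneq (j : nat) i.+1; first by rewrite /orient /cross /vec /=; lra.
case: (ltnP i j) => lt; first by apply/Rlt_le/pt_ccw; lia.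
by rewrite -orient_cycle; apply/Rlt_le/pt_ccw; lia.
Qed.

Definition unit_rel : rel 'I_n := fun i j => is_unit (pt i) (pt j).
Definition ahead : rel 'I_n := fun i j =>
  if Rle_dec 0 (dot (tangent i) (vec (pt i) (pt j))) then true else false.

Lemma aheadP i j : ahead i j -> (0 <= dot (tangent i) (vec (pt i) (pt j)))%coqR.
Proof. by rewrite /ahead; case: Rle_dec. Qed.

Lemma aheadNP i j : ~~ ahead i j -> (dot (tangent i) (vec (pt i) (pt j)) <= 0)%coqR.
Proof. by rewrite /ahead; case: Rle_dec => // *; lra. Qed.

Lemma unit_irr : irreflexive unit_rel.
Proof. by move=> i; rewrite /unit_rel is_unit_irrefl. Qed.

Lemma unit_arc i j : unit_rel i j -> 0 < arc i j.
Proof. by move=> u; rewrite arc_gt0; apply: contraTneq u => ->; rewrite unit_irr. Qed.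

Lemma unit_dot i j : unit_rel i j -> dot (vec (pt i) (pt j)) (vec (pt i) (pt j)) = 1%coqR.
Proof. exact: is_unitP. Qed.

Lemma unit_rel_sym : symmetric unit_rel.
Proof. by move=> i j; apply: is_unit_sym. Qed.

(** The tangent inequality applies at both [p] and [q], making each zigzag angle smaller than the
    other. *)
Lemma polygon_no_both p q p' q' :
  both unit_rel ahead p q -> both unit_rel ahead p p' -> both unit_rel ahead q q' ->
  arc p q < arc p p' -> arc q p < arc q q' -> False.
Proof.
move=> /and3P[u1 _ _] /and3P[u2 a2 _] /and3P[u3 a3 _] l1 l2.
have u1' : unit_rel q p by rewrite unit_rel_sym.
have o1 := orient_arc (unit_arc u1) l1; have o2 := orient_arc (unit_arc u1') l2.
have := angle_lt_of_tangent _ _ _ _ _ (unit_dot u1) (unit_dot u2) (unit_dot u3) o1 o2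
  (@tangent_neq0 q) (tangent_support q p) (tangent_support q p')
  (tangent_support q q') (aheadP a3).
have := angle_lt_of_tangent _ _ _ _ _ (unit_dot u1') (unit_dot u3) (unit_dot u2) o2 o1
  (@tangent_neq0 p) (tangent_support p q) (tangent_support p q')
  (tangent_support p p') (aheadP a2).
lra.
Qed.

Lemma polygon_no_neither p q p' q' :
  neither unit_rel ahead p q -> neither unit_rel ahead p p' ->
  neither unit_rel ahead q q' ->
  arc p p' < arc p q -> arc q q' < arc q p -> False.
Proof.
move=> /and3P[u1 _ _] /and3P[u2 a2 _] /and3P[u3 a3 _] l1 l2.
have u1' : unit_rel q p by rewrite unit_rel_sym.
have o1 : (orient (pt p) (pt q) (pt p') < 0)%coqR.
  by rewrite orient_swap; have := orient_arc (unit_arc u2) l1; lra.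
have o2 : (orient (pt q) (pt p) (pt q') < 0)%coqR.
  by rewrite orient_swap; have := orient_arc (unit_arc u3) l2; lra.
have := angle_lt_of_tangent_flip _ _ _ _ _ (unit_dot u1) (unit_dot u2) (unit_dot u3) o1 o2
  (@tangent_neq0 q) (tangent_support q p) (tangent_support q p')
  (tangent_support q q') (aheadNP a3).
have := angle_lt_of_tangent_flip _ _ _ _ _ (unit_dot u1') (unit_dot u3) (unit_dot u2) o2 o1
  (@tangent_neq0 p) (tangent_support p q) (tangent_support p q')
  (tangent_support p p') (aheadNP a2).
lra.
Qed.

(** In the zigzag [d, a, f, c], the segment [fc] is ahead at [f], while [b] is an inner neighbour of
    [d]; the two angle lemmas contradict each other. *)
Lemma polygon_no_mixed a b c f d :
  mixed unit_rel ahead a f -> mixed unit_rel ahead a d ->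
  mixed unit_rel ahead b d -> mixed unit_rel ahead c f ->
  0 < arc a b -> arc a b < arc a c -> arc a c < arc a f -> arc a f < arc a d -> False.
Proof.
move=> /and3P[uaf _ _] /and3P[uad _ _] /and3P[ubd _ _] /and3P[ucf _ a_fc] l0 l1 l2 l3.
have ufc : unit_rel f c by rewrite unit_rel_sym.
have o1 := orient_arc (unit_arc uaf) l3.
have c0 := ltn_trans l0 l1.
have o2 := orient_arc c0 l2; rewrite -orient_cycle in o2.
have := angle_lt_of_tangent _ _ _ _ _ (unit_dot uaf) (unit_dot uad) (unit_dot ufc) o1 o2
  (@tangent_neq0 f) (tangent_support f a) (tangent_support f d)
  (tangent_support f c) (aheadP a_fc).
have := angle_lt_of_inner_neighbour _ _ _ _ _
  (unit_dot uaf) (unit_dot uad) (unit_dot ufc) (unit_dot ubd) o1 o2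
  (orient_arc l0 l1) (orient_arc c0 (ltn_trans l2 l3))
  (orient_arc l0 (ltn_trans l1 (ltn_trans l2 l3))).
lra.
Qed.

Lemma polygon_unit_bound :
  \sum_(i < n) \sum_(j < n) ((i < j) && unit_rel i j) <= n * (2 * trunc_log 2 n + 4).
Proof.
exact: (card_pattern_free unit_rel_sym polygon_no_both polygon_no_neither
          polygon_no_mixed unit_irr).
Qed.
End ConvexPolygon.

Lemma convex_unit_edges (Q : list point) : (2 <= length Q)%coq_nat -> NoDup Q ->
    (forall i j k, (i < j)%coq_nat -> (j < k)%coq_nat -> (k < length Q)%coq_nat ->
      (0 < orient (List.nth i Q (0, 0)) (List.nth j Q (0, 0)) (List.nth k Q (0, 0)))%coqR) ->
  exists L, (Nat.pow 2 L <= length Q)%coq_nat /\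
    (unit_edges Q <= length Q * (2 * L + 4))%coq_nat.
Proof.
move=> n2 ND ccw; exists (trunc_log 2 (length Q)); split.
  have /andP[+ _] := trunc_log_bounds (isT : 1 < 2) (ltac:(lia) : 0 < length Q).
  have -> k : expn 2 k = Nat.pow 2 k by elim: k => //= k <-; rewrite expnS; lia.
  by move=> ?; lia.
apply/leP; rewrite (unit_edgesE _ (0, 0)%coqR).
apply: (@polygon_unit_bound _ (fun i => List.nth i Q (0, 0)%coqR)) => [i j k *|i j lt1 lt2 e|].
- by apply: ccw; lia.
- by have := proj1 (NoDup_nth Q (0, 0)%coqR) ND i j ltac:(lia) ltac:(lia) e; lia.
- lia.
Qed.
End Polygon.

(** * The bound with the real logarithm *)

Theorem theorem4p3 :
  exists C : R,
    forall P : list point,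
      NoDup P ->
      convexly_independent P ->
      (2 <= length P)%nat ->
      INR (unit_edges P) <=
        2 * INR (length P) * log2 (INR (length P)) + C * INR (length P).
Proof.
(* Each vertex pays 1 for its last [both] segment, 1 for its first [neither] segment, and the
   additive 1 in each of the two logarithmic counts. *)
exists 4; intros P ND CI H2.
destruct (convex_sort P ND) as [Q [PQ ccw]]; [intros ->; cbn in H2; lia|assumption|].
rewrite (unit_edges_perm _ _ PQ), (Permutation_length PQ) in *.
destruct (Polygon.convex_unit_edges H2 (Permutation_NoDup PQ ND) ccw) as [L [HL HU]].
apply le_INR in HU, HL.
rewrite mult_INR, plus_INR, mult_INR in HU; rewrite pow_INR in HL; cbn [INR] in HU, HL.
replace (1 + 1) with 2 in HL by lra.
set (n := INR (length Q)) in *.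
assert (l2 : 0 < ln 2) by (rewrite <- ln_1; apply ln_increasing; lra).
assert (p2 : 0 < 2 ^ L) by (apply pow_lt; lra).
assert (K : INR L <= log2 n).
{ unfold log2; apply Rmult_le_reg_r with (ln 2); [assumption|].
  unfold Rdiv; rewrite Rmult_assoc, Rinv_l, Rmult_1_r by lra.
  rewrite <- ln_pow by lra.
  destruct HL as [HL|HL]; [left; apply ln_increasing; lra|right; f_equal; lra]. }
assert (0 <= n) by lra.
nra.
Qed.
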